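(* Let $f:\Theta^*\to Z$. Then $f$ is mixed-Nash-implementable on the state space $\Theta_{\mathbb R}=\{(\theta,u):\theta\in\Theta^*,u\in\Omega^{[\succeq^\theta,\mathbb R]}\}$ (with $f(\theta,u)=f(\theta)$) if and only if it is mixed-Nash-implementable on the state space $\Theta_{\mathbb Q}=\{(\theta,u):\theta\in\Theta^*,u\in\Omega^{[\succeq^\theta,\mathbb Q]}\}$ (with $f(\theta,u)=f(\theta)$). Explicitly: there is a mechanism $\mathcal M$ with $\bigcup_{\lambda\in MNE^{(\mathcal M,u)}}\mathrm{SUPP}(g[\lambda])=\{f(\theta)\}$ for all $\theta\in\Theta^*$ and all $u\in\Omega^{[\succeq^\theta,\mathbb R]}$ iff there is a mechanism with the same property for all $\theta\in\Theta^*$ and all $u\in\Omega^{[\succeq^\theta,\mathbb Q]}$.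
   Context: Ordinal model: $\mathcal I=\{1,\dots,I\}$ finite with $I\ge3$; $Z$ finite; $Y=\Delta(Z)$; $\Theta^*$ is a finite set of ordinal states, each $\theta\in\Theta^*$ specifying a profile $(\succeq_i^\theta)_{i\in\mathcal I}$ of complete preorders on $Z$; $f:\Theta^*\to Z$ with $|f(\Theta^* )|\ge 2$. For a field $\mathbb K\in\{\mathbb R,\mathbb Q\}$, $\Omega^{[\succeq^\theta,\mathbb K]}$ is the set of profiles $u=(u_i:Z\to\mathbb K)_{i}$ with $z\succeq_i^\theta z'\iff u_i(z)\ge u_i(z')$ for all $i,z,z'$. At cardinal state $u$, agent $i$ evaluates $y\in Y$ by $U_i(y)=\sum_z y_zu_i(z)$. A mechanism $\mathcal M=\langle M=\times_iM_i,g:M\to Y\rangle$ has countable $M_i$; $g(\lambda)$ is the lottery induced by a profile $\lambda$; $MNE^{(\mathcal M,u)}$ is the set of mixed-strategy Nash equilibria under utilities $u$. *)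

(* Defs.v *)
From HB Require Import structures.
From mathcomp Require Import all_boot all_order all_algebra.
From mathcomp Require Import classical_sets boolp reals ereal esum.
Set Implicit Arguments. Unset Strict Implicit. Unset Printing Implicit Defensive.
Import Order.TTheory GRing.Theory Num.Theory.
Local Open Scope ring_scope.

Section Model.
Variables (R : realType) (n : nat) (Z : finType).

Definition complete_preorder (r : rel Z) : Prop :=
  (forall x y, r x y || r y x) /\ (forall x y w, r x y -> r y w -> r x w).

Definition lottery (y : Z -> R) : Prop :=
  (forall z, 0 <= y z) /\ \sum_(z : Z) y z = 1.

Definition represents (K : numDomainType) (pref : 'I_n -> rel Z)
  (u : 'I_n -> Z -> K) : Prop :=
  forall i z z', pref i z z' <-> u i z' <= u i z.

Record mechanism := Mechanism {
  msg : 'I_n -> countType;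
  outcome : {dffun forall i, msg i} -> Z -> R;
  outcome_lottery : forall m, lottery (outcome m) }.

Definition mixed (T : countType) (l : T -> R) : Prop :=
  (forall t, 0 <= l t) /\ (\esum_(t in [set: T]) (l t)%:E = 1)%E.

Definition mixed_profile (G : mechanism) (lam : forall i, msg G i -> R) : Prop :=
  forall i, mixed (lam i).

Definition induced (G : mechanism) (lam : forall i, msg G i -> R) (z : Z) : R :=
  fine (\esum_(m in [set: {dffun forall i, msg G i}])
          ((\prod_(i < n) lam i (m i)) * outcome m z)%:E).

Definition exp_util (u : 'I_n -> Z -> R) (i : 'I_n) (y : Z -> R) : R :=
  \sum_(z : Z) y z * u i z.

Definition MNE (G : mechanism) (u : 'I_n -> Z -> R)
  (lam : forall i, msg G i -> R) : Prop :=
  mixed_profile lam /\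
  forall (i : 'I_n) (mu : msg G i -> R), mixed mu ->
    exp_util u i (induced (dfwith lam mu)) <= exp_util u i (induced lam).

Definition MNE_support_is (G : mechanism) (u : 'I_n -> Z -> R) (x : Z) : Prop :=
  forall z, (exists lam, @MNE G u lam /\ 0 < induced lam z) <-> z = x.

End Model.

Definition MN_implementable_R (R : realType) (n : nat) (Z Theta : finType)
  (pref : Theta -> 'I_n -> rel Z) (f : Theta -> Z) : Prop :=
  exists G : mechanism R n Z,
    forall (th : Theta) (u : 'I_n -> Z -> R),
      represents (pref th) u -> MNE_support_is G u (f th).

Definition MN_implementable_Q (R : realType) (n : nat) (Z Theta : finType)
  (pref : Theta -> 'I_n -> rel Z) (f : Theta -> Z) : Prop :=
  exists G : mechanism R n Z,
    forall (th : Theta) (u : 'I_n -> Z -> rat),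
      represents (pref th) u ->
      MNE_support_is G (fun i z => ratr (u i z)) (f th).

(* Main.v *)
(** If [f] is implemented by [G] on rational utilities, fix for each state an equilibrium of [G]
    at the rank utilities. The set of outcomes that one agent can reach against it is an ordinal
    datum. The equilibria persist under every rational utility that is dominated, on the
    reachable outcomes, by a multiple of the rank utilities, so implementation forces ordinal
    conditions on these sets ([deviation_witness]).

    Conversely such sets yield an integer-game mechanism that works for real utilities. All agents
    announce a state and an index [k]. A single dissenter at state [th] gets, up to a perturbation
    which vanishes as the dissenter's integer grows, a lottery [(1 - 1/(k+1)) z + 1/(k+1) x] with
    [z] strictly worse than [f th], or both no better. For given real utilities no such lottery
    is profitable once [k] is large, whereas one of them is profitable in every state with another
    value of [f]. In all remaining profiles an integer game would make every outcome in the support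
    optimal. Mixed equilibria are no harder than pure ones: up to [e] and on finitely many
    profiles each agent has a dominant message, hence every profile in the support of an
    equilibrium is a pure equilibrium. *)
Require Import Defs.
From HB Require Import structures.
From mathcomp Require Import all_boot all_order all_algebra.
From mathcomp Require Import classical_sets boolp reals ereal esum.
From mathcomp Require Import functions cardinality fsbigop ring lra zify.
Set Implicit Arguments.
Unset Strict Implicit.
Unset Printing Implicit Defensive.
Import Order.TTheory GRing.Theory Num.Theory.
Local Open Scope ring_scope.

(** * Sums of nonnegative families *)

Section Esum.
Variable R : realType.
Local Open Scope classical_set_scope.
Local Open Scope ereal_scope.

(** Finite partial sums give one inequality; the other is the same inequality for the inverse of
    [c]. *)
Lemma ge0_esumZl (T : choiceType) (A : set T) (c : R) (a : T -> \bar R) :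
  (0 <= c)%R -> (forall t, 0 <= a t) ->
  \esum_(t in A) (c%:E * a t) = c%:E * \esum_(t in A) a t.
Proof.
have le (d : R) (b : T -> \bar R) : (0 <= d)%R -> (forall t, 0 <= b t) ->
    \esum_(t in A) (d%:E * b t) <= d%:E * \esum_(t in A) b t.
  move=> d0 b0; apply: ge_ereal_sup => _ [X [finX XA] <-].
  rewrite -ge0_mule_fsumr//; apply: lee_wpmul2l; first by rewrite lee_fin.
  by apply: ereal_sup_ubound; exists X.
rewrite le_eqVlt => /predU1P[<-|c0] a0.
  by rewrite mul0e esum1// => t _; rewrite mul0e.
apply/eqP; rewrite eq_le le ?(ltW c0)//=.
rewrite -[leRHS]mul1e -(divff (lt0r_neq0 c0)) EFinM -muleA.
apply: lee_wpmul2l; first by rewrite lee_fin ltW.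
under eq_esum => t _ do rewrite -[a t]mul1e -(mulVf (lt0r_neq0 c0)) EFinM -muleA.
apply: le; first by rewrite invr_ge0 (ltW c0).
by move=> t; rewrite mule_ge0// lee_fin (ltW c0).
Qed.

Lemma exchange_esum (T1 T2 : choiceType) (A : set T1) (B : set T2)
    (a : T1 -> T2 -> \bar R) : (forall s t, 0 <= a s t) ->
  \esum_(s in A) \esum_(t in B) a s t = \esum_(t in B) \esum_(s in A) a s t.
Proof.
move=> a0; rewrite esum_esum// esum_esum//.
rewrite (reindex_esum (B `*`` fun=> A) _ (fun p => (p.2, p.1)))//; split.
- by move=> [x y] /= [].
- by move=> [x y] [x' y'] _ _ [-> ->].
- by move=> [x y] /= [Ax By]; exists (y, x).
Qed.

End Esum.

(** * Product probabilities on message profiles *)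

Section Profiles.
Variables (R : realType) (n : nat) (msg : 'I_n -> countType).
Local Notation profile := {dffun forall i, msg i}.
Local Open Scope classical_set_scope.

Definition upd (m : profile) (i : 'I_n) (t : msg i) : profile :=
  finfun (dfwith (fun j => m j) t).
Arguments upd : clear implicits.

Lemma upd_in m i t : upd m i t i = t.
Proof. by rewrite ffunE dfwith_in. Qed.

Lemma upd_out m i t j : i != j -> upd m i t j = m j.
Proof. by move=> ij; rewrite ffunE dfwith_out. Qed.

Lemma upd_id m i : upd m i (m i) = m.
Proof.
apply/ffunP => j; have [<-|ij] := eqVneq i j; first by rewrite upd_in.
by rewrite upd_out.
Qed.

Lemma upd_upd m i s t : upd (upd m i s) i t = upd m i t.
Proof.
apply/ffunP => j; have [<-|ij] := eqVneq i j; first by rewrite !upd_in.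
by rewrite !upd_out.
Qed.

(** Fubini along coordinate [i]: a set closed under changes of this coordinate is the product of its
    slice at [t0] with the messages of [i]. The choice of [t0] only fixes representatives. *)
Lemma esum_coord (A : set profile) i (t0 : msg i) (a : profile -> \bar R) :
  (forall m t, A m -> A (upd m i t)) -> (forall m, (0 <= a m)%E) ->
  (\esum_(m in A) a m =
   \esum_(m in A `&` [set m | m i = t0]) \esum_(t in setT) a (upd m i t))%E.
Proof.
move=> Aupd a0; rewrite esum_esum//.
apply: (reindex_esum _ _ (fun p => upd p.1 i p.2)); split.
- by move=> [m t] /= [[Am _] _]; apply: Aupd.
- move=> [m t] [m' t'] /set_mem /= [[_ mi] _] /set_mem /= [[_ mi'] _] e.
  have tt' : t = t' by move: (congr1 (fun m : profile => m i) e); rewrite !upd_in.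
  rewrite tt'; congr pair.
  move: (congr1 (fun m : profile => upd m i t0) e); rewrite !upd_upd.
  by rewrite -{1}mi -{1}mi' !upd_id.
- move=> m /= Am; exists (upd m i t0, m i) => /=; last by rewrite upd_upd upd_id.
  by split=> //; split; [exact: Aupd|rewrite upd_in].
Qed.

Definition prob (lam : forall i, msg i -> R) (m : profile) : R :=
  \prod_(i < n) lam i (m i).

Definition eexp (lam : forall i, msg i -> R) (F : profile -> R) : \bar R :=
  (\esum_(m in setT) (prob lam m * F m)%:E)%E.

(** [fine] sends an infinite sum to 0; by [EFin_Ex] this default does not arise for mixed [lam] and
    bounded nonnegative [F]. *)
Definition Ex (lam : forall i, msg i -> R) (F : profile -> R) : R :=
  fine (eexp lam F).

Implicit Types (lam : forall i, msg i -> R) (F : profile -> R) (m : profile).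

Lemma prob_ge0 lam m : (forall i t, 0 <= lam i t) -> 0 <= prob lam m.
Proof. by move=> l0; apply: prodr_ge0. Qed.

Lemma mixed_gt0 (T : countType) (l : T -> R) : mixed l -> exists t, 0 < l t.
Proof.
move=> [l0 l1]; apply: contrapT => nex.
have z t : l t = 0.
  by apply/eqP; rewrite eq_le l0 andbT leNgt; apply/negP => lt; apply: nex; exists t.
have : (\esum_(t in [set: T]) (l t)%:E = 0)%E by apply: esum1 => t _; rewrite z.
by rewrite l1 => /eqP; rewrite eqe oner_eq0.
Qed.

Lemma prob_bigD1 lam m i : prob lam m = lam i (m i) * \prod_(j | j != i) lam j (m j).
Proof. by rewrite /prob (bigD1 i). Qed.

Lemma prod_upd lam m i t :
  \prod_(j | j != i) lam j (upd m i t j) = \prod_(j | j != i) lam j (m j).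
Proof. by apply: eq_bigr => j ji; rewrite upd_out// eq_sym. Qed.

Lemma prob_total lam : (forall i, mixed (lam i)) ->
  (\esum_(m in [set: profile]) (prob lam m)%:E = 1)%E.
Proof.
move=> lmix; have l0 i t : 0 <= lam i t by case: (lmix i).
pose m0 : profile := finfun (fun i => sval (cid (mixed_gt0 (lmix i)))).
(* Induction on the coordinates summed over; all others stay frozen at [m0]. *)
have part (s : seq 'I_n) : uniq s ->
    (\esum_(m in [set m : profile | forall i, i \notin s -> m i = m0 i])
      (\prod_(i <- s) lam i (m i))%:E = 1)%E.
  elim: s => [_|j s IHs /= /andP[js us]].
    rewrite (_ : [set m | _] = [set m0]) ?esum_set1 ?big_nil//.
    apply/seteqP; split => [m /= mm0|m -> //].
    by apply/ffunP => i; apply: mm0.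
  rewrite (esum_coord (m0 j)).
  - rewrite -[RHS]IHs// (_ : _ `&` _ = [set m : profile | forall i, i \notin s -> m i = m0 i]).
      apply: eq_esum => m _.
      have updE t : \prod_(i <- s) lam i (upd m j t i) = \prod_(i <- s) lam i (m i).
        rewrite big_seq [RHS]big_seq; apply: eq_bigr => i si.
        by rewrite upd_out//; apply: contraNneq js => ->.
      under eq_esum => t _ do rewrite big_cons upd_in mulrC EFinM updE.
      rewrite ge0_esumZl ?prodr_ge0//; last by move=> t; rewrite lee_fin.
      by have [_ ->] := lmix j; rewrite mule1.
    apply/seteqP; split => [m /= [mm0 mj] i si|m /= mm0].
      have [->//|ij] := eqVneq i j.
      by apply: mm0; rewrite inE negb_or ij.
    split; last exact: mm0.
    by move=> i; rewrite inE negb_or => /andP[_]; apply: mm0.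
  - move=> m t mm0 i; rewrite inE negb_or => /andP[ij si].
    by rewrite upd_out 1?eq_sym// mm0// inE negb_or ij.
  - by move=> m; rewrite lee_fin prodr_ge0.
rewrite -[RHS](part (enum 'I_n) (enum_uniq _)).
rewrite (_ : [set m | _] = setT); last first.
  by apply/seteqP; split => // m _ i; rewrite mem_enum.
by apply: eq_esum => m _; rewrite /prob big_enum.
Qed.

(** Both sides are split along coordinate [i]. On the right the integrand ignores [m i], so the
    weights [lam i] sum to 1 and drop out. *)
Lemma eexp_dfwith lam i (mu : msg i -> R) F :
  (forall i, mixed (lam i)) -> mixed mu -> (forall m, 0 <= F m) ->
  (eexp (dfwith lam mu) F =
   \esum_(t in setT) ((mu t)%:E * eexp lam (fun m => F (upd m i t))))%E.
Proof.
move=> lmix mumix F0; have l0 j s : 0 <= lam j s by case: (lmix j).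
have [mu0 _] := mumix; have [t0 _] := mixed_gt0 mumix.
have dl0 j (s : msg j) : 0 <= dfwith lam mu j s.
  by move: s; case: (dfwithP lam mu j) => // k _ s; exact: l0.
rewrite {1}/eexp (esum_coord t0)//; last first.
  by move=> m; rewrite lee_fin mulr_ge0// prob_ge0//.
rewrite exchange_esum; last first.
  by move=> m t; rewrite lee_fin mulr_ge0// prob_ge0.
apply: eq_esum => t _.
rewrite [X in (_ = _ * X)%E](esum_coord t0)//; last first.
  by move=> m; rewrite lee_fin mulr_ge0// prob_ge0.
rewrite -ge0_esumZl//; last first.
  by move=> m; apply: esum_ge0 => s _; rewrite lee_fin mulr_ge0// prob_ge0.
apply: eq_esum => m _.
under [in RHS]eq_esum => s _.
  rewrite (prob_bigD1 _ _ i) upd_in prod_upd upd_upd -mulrA mulrC EFinM; over.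
rewrite ge0_esumZl ?mulr_ge0// ?prodr_ge0//; last by move=> s; rewrite lee_fin.
have [_ ->] := lmix i; rewrite mule1 -EFinM; congr (_%:E).
rewrite (prob_bigD1 _ _ i) upd_in dfwith_in mulrA; congr (_ * _ * _).
by apply: eq_bigr => j ji; rewrite upd_out ?dfwith_out// eq_sym.
Qed.

End Profiles.
Arguments upd {n msg} m i t.

(** * Expectation of bounded nonnegative functions *)

Section Expectation.
Variables (R : realType) (n : nat) (msg : 'I_n -> countType).
Local Notation profile := {dffun forall i, msg i}.
Variable lam : forall i, msg i -> R.
Arguments lam : clear implicits.
Hypothesis lmix : forall i, mixed (lam i).
Implicit Types F H : profile -> R.

(** [esum] is a supremum of finite sums, which is the right sum only for nonnegative terms; the
    bound makes it finite. *)
Definition bounded_ge0 F := exists B : R, forall m, 0 <= F m <= B.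

Let lam_ge0 i t : 0 <= lam i t. Proof. by case: (lmix i). Qed.

Lemma eexp_ge0 F : (forall m, 0 <= F m) -> (0 <= eexp lam F)%E.
Proof. by move=> F0; apply: esum_ge0 => m _; rewrite lee_fin mulr_ge0// prob_ge0. Qed.

Lemma eexp_cst (c : R) : 0 <= c -> eexp lam (fun=> c) = c%:E.
Proof.
move=> c0; rewrite /eexp.
under eq_esum => m _ do rewrite mulrC EFinM.
rewrite ge0_esumZl//; last by move=> m; rewrite lee_fin prob_ge0.
by rewrite prob_total// mule1.
Qed.

Lemma EFin_Ex F : bounded_ge0 F -> (Ex lam F)%:E = eexp lam F.
Proof.
move=> [B FB]; have F0 m : 0 <= F m by case/andP: (FB m).
have [B0|B0] := leP 0 B; last first.
  have [m _] : exists m : profile, True.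
    by exists (finfun (fun i => sval (cid (mixed_gt0 (lmix i))))).
  by have /andP[/le_trans h /h] := FB m; rewrite leNgt B0.
rewrite fineK// ge0_fin_numE ?eexp_ge0//.
apply: (@le_lt_trans _ _ B%:E); last exact: ltry.
rewrite -(eexp_cst B0); apply: le_esum => m _.
by rewrite lee_fin ler_wpM2l ?prob_ge0//; case/andP: (FB m).
Qed.

Lemma ler_Ex F H : bounded_ge0 F -> bounded_ge0 H ->
  (forall m, 0 < prob lam m -> F m <= H m) -> Ex lam F <= Ex lam H.
Proof.
move=> bF bH FH; rewrite -lee_fin !EFin_Ex//; apply: le_esum => m _.
have := prob_ge0 m lam_ge0; rewrite le_eqVlt => /predU1P[<-|p0].
  by rewrite !mul0r.
by rewrite lee_fin ler_wpM2l ?(ltW p0)// FH.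
Qed.

Lemma bounded_ge0_cst (c : R) : 0 <= c -> bounded_ge0 (fun=> c).
Proof. by exists c => m; rewrite lexx andbT. Qed.

Lemma bounded_ge0D F H : bounded_ge0 F -> bounded_ge0 H ->
  bounded_ge0 (fun m => F m + H m).
Proof.
move=> [B FB] [C HC]; exists (B + C) => m.
by have /andP[? ?] := FB m; have /andP[? ?] := HC m; rewrite addr_ge0// lerD.
Qed.

Lemma bounded_ge0Z (c : R) F : 0 <= c -> bounded_ge0 F ->
  bounded_ge0 (fun m => c * F m).
Proof.
move=> c0 [B FB]; exists (c * B) => m.
by have /andP[? ?] := FB m; rewrite mulr_ge0// ler_wpM2l.
Qed.

Lemma bounded_ge0_bool (P : pred profile) : bounded_ge0 (fun m => (P m)%:R).
Proof. by exists 1 => m; case: (P m); rewrite !lexx ?ler01. Qed.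

Lemma Ex_cst (c : R) : 0 <= c -> Ex lam (fun=> c) = c.
Proof. by move=> c0; rewrite /Ex eexp_cst. Qed.

Lemma ExD F H : bounded_ge0 F -> bounded_ge0 H ->
  Ex lam (fun m => F m + H m) = Ex lam F + Ex lam H.
Proof.
move=> bF bH; apply: EFin_inj; rewrite EFinD !EFin_Ex//; last exact: bounded_ge0D.
have [[B FB] [C HC]] := (bF, bH).
rewrite /eexp -esumD.
- by apply: eq_esum => m _; rewrite mulrDr EFinD.
- by move=> m _; rewrite lee_fin mulr_ge0 ?prob_ge0//; case/andP: (FB m).
- by move=> m _; rewrite lee_fin mulr_ge0 ?prob_ge0//; case/andP: (HC m).
Qed.

Lemma ExZ (c : R) F : 0 <= c -> bounded_ge0 F ->
  Ex lam (fun m => c * F m) = c * Ex lam F.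
Proof.
move=> c0 bF; apply: EFin_inj; rewrite EFinM !EFin_Ex//; last exact: bounded_ge0Z.
have [B FB] := bF; rewrite /eexp.
under eq_esum => m _ do rewrite mulrCA EFinM.
rewrite ge0_esumZl// => m.
by rewrite lee_fin mulr_ge0 ?prob_ge0//; case/andP: (FB m).
Qed.

Lemma Ex_point m0 : Ex lam (fun m => (m == m0)%:R) = prob lam m0.
Proof.
rewrite /Ex /eexp.
rewrite (_ : esum _ _ = \esum_(m in [set m0]%classic) (prob lam m)%:E)%E.
  by rewrite esum_set1// lee_fin prob_ge0.
rewrite [RHS]esum_mkcond; apply: eq_esum => m _.
have [->|mm0] := eqVneq m m0; first by rewrite mem_set// mulr1.
by rewrite memNset ?mulr0//= => e; rewrite e eqxx in mm0.
Qed.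

(* The total mass 1 is a supremum of finite sums. *)
Lemma Ex_tail (e : R) : 0 < e ->
  exists s : seq profile, Ex lam (fun m => (m \notin s)%:R) <= e.
Proof.
move=> e0.
have : ((1 - e)%:E < \esum_(m in [set: profile]) (prob lam m)%:E)%E.
  by rewrite prob_total// lte_fin ltrBlDr ltrDl.
move=> /ereal_sup_gt[_ [X [finX _] <-]].
have [s ->] := (finite_seqP X).1 finX; move=> lt; exists s.
have bN := bounded_ge0_bool (fun m => m \notin s).
have bX := bounded_ge0_bool (fun m => m \in s).
have tot : Ex lam (fun m => (m \in s)%:R) + Ex lam (fun m => (m \notin s)%:R) = 1.
  rewrite -ExD// -[RHS](Ex_cst ler01); congr (Ex lam _).
  by apply: funext => m; case: (m \in _); rewrite ?addr0 ?add0r.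
suff : 1 - e <= Ex lam (fun m => (m \in s)%:R) by lra.
rewrite -lee_fin EFin_Ex//; apply: le_trans (ltW lt) _.
apply: esum_ge; exists [set` s]%classic => //.
apply: lee_fsum => // m ms.
by rewrite (_ : m \in s) ?mulr1.
Qed.

End Expectation.

(** * Expected utility of a lottery *)

Section Lotteries.
Variables (R : realType) (n : nat) (Z : finType) (u : 'I_n -> Z -> R) (i : 'I_n).
Variables (y : Z -> R) (K : R).
Hypothesis y_lottery : lottery y.

Lemma le_exp_util : (forall z, 0 < y z -> K <= u i z) -> K <= exp_util u i y.
Proof.
have [y0 y1] := y_lottery.
move=> Ku; rewrite -[K]mul1r -y1 mulr_suml; apply: ler_sum => z _.
have := y0 z; rewrite le_eqVlt => /predU1P[<-|yz]; first by rewrite !mul0r.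
by rewrite ler_wpM2l ?(ltW yz)// Ku.
Qed.

Lemma exp_util_le : (forall z, 0 < y z -> u i z <= K) -> exp_util u i y <= K.
Proof.
have [y0 y1] := y_lottery.
move=> Ku; rewrite -[K]mul1r -y1 mulr_suml; apply: ler_sum => z _.
have := y0 z; rewrite le_eqVlt => /predU1P[<-|yz]; first by rewrite !mul0r.
by rewrite ler_wpM2l ?(ltW yz)// Ku.
Qed.

Lemma exp_util_max : (forall z, u i z <= K) -> K <= exp_util u i y ->
  forall z, 0 < y z -> u i z = K.
Proof.
have [y0 y1] := y_lottery.
move=> uK Ky z yz; apply/eqP; rewrite eq_le uK/= leNgt; apply/negP => lt.
move: Ky; rewrite leNgt => /negP; apply.
rewrite -[K]mul1r -y1 mulr_suml /exp_util (bigD1 z)//= [X in _ < X](bigD1 z)//=.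
apply: ltr_leD; first by rewrite ltr_pM2l.
by apply: ler_sum => w _; rewrite ler_wpM2l.
Qed.

End Lotteries.

(** * Mixed equilibria through pure deviations and pure profiles *)

Section Games.
Variables (R : realType) (n : nat) (Z : finType) (G : mechanism R n Z).
Local Notation profile := {dffun forall i, msg G i}.
Implicit Types (lam : forall i, msg G i -> R) (u : 'I_n -> Z -> R).

Lemma outcome_ge0 (m : profile) z : 0 <= outcome m z.
Proof. by case: (outcome_lottery m). Qed.

Lemma outcome_sum (m : profile) : \sum_z outcome m z = 1.
Proof. by case: (outcome_lottery m). Qed.

Lemma outcome_le1 (m : profile) z : outcome m z <= 1.
Proof.
rewrite -(outcome_sum m) (bigD1 z)//= lerDl.
by apply: sumr_ge0 => ? _; exact: outcome_ge0.
Qed.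

Lemma bounded_ge0_outcome z : bounded_ge0 (fun m : profile => outcome m z).
Proof. by exists 1 => m; rewrite outcome_ge0 outcome_le1. Qed.

Lemma bounded_ge0_sum (v : Z -> R) : (forall z, 0 <= v z) ->
  bounded_ge0 (fun m : profile => \sum_z outcome m z * v z).
Proof.
move=> v0; exists (\sum_z v z) => m; apply/andP; split.
  by apply: sumr_ge0 => z _; rewrite mulr_ge0// outcome_ge0.
by apply: ler_sum => z _; rewrite -[leRHS]mul1r ler_wpM2r// outcome_le1.
Qed.

Lemma sum_induced lam (v : Z -> R) : mixed_profile lam -> (forall z, 0 <= v z) ->
  \sum_z induced lam z * v z = Ex lam (fun m => \sum_z outcome m z * v z).
Proof.
move=> lmix v0; have l0 j s : 0 <= lam j s by case: (lmix j).
apply: EFin_inj; rewrite (EFin_Ex lmix)//; last exact: bounded_ge0_sum.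
rewrite -sumEFin /eexp.
under [RHS]eq_esum => m _ do rewrite mulr_sumr -sumEFin.
rewrite esum_sum; last first.
  by move=> m z _ _; rewrite lee_fin !mulr_ge0 ?outcome_ge0 ?prob_ge0.
apply: eq_bigr => z _; rewrite mulrC EFinM.
rewrite (EFin_Ex lmix (bounded_ge0_outcome z)) /eexp -ge0_esumZl//.
  by apply: eq_esum => m _; rewrite -EFinM; congr (_%:E); ring.
by move=> m; rewrite lee_fin mulr_ge0 ?outcome_ge0 ?prob_ge0.
Qed.

Lemma induced_total lam : mixed_profile lam -> \sum_z induced lam z = 1.
Proof.
move=> lmix; have := @sum_induced lam (fun=> 1) lmix (fun=> ler01).
under eq_bigr do rewrite mulr1.
move=> ->; rewrite -[RHS](Ex_cst lmix ler01); congr (Ex lam _).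
apply: funext => m; under eq_bigr do rewrite mulr1.
exact: outcome_sum.
Qed.

Lemma induced_gt0P lam z : mixed_profile lam ->
  0 < induced lam z <-> exists m, 0 < prob lam m /\ 0 < outcome m z.
Proof.
move=> lmix; have l0 j s : 0 <= lam j s by case: (lmix j).
have b0 := bounded_ge0_outcome z; split=> [i0|[m [pm om]]].
  apply: contrapT => nex; suff : induced lam z <= 0 by rewrite leNgt i0.
  rewrite -[X in _ <= X](Ex_cst lmix (lexx 0)).
  apply: (ler_Ex lmix b0 (bounded_ge0_cst _ (lexx 0))) => m pm.
  by rewrite leNgt; apply/negP => om; apply: nex; exists m.
(* The contribution of the single profile [m] is a lower bound. *)
apply: (@lt_le_trans _ _ (outcome m z * prob lam m)); first exact: mulr_gt0.
rewrite -(Ex_point lmix) -(ExZ lmix) ?outcome_ge0//; last exact: bounded_ge0_bool.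
apply: (ler_Ex lmix) => //.
  by apply: bounded_ge0Z; [exact: outcome_ge0|exact: bounded_ge0_bool].
move=> m' _; have [->|_] := eqVneq m' m; first by rewrite mulr1.
by rewrite mulr0 outcome_ge0.
Qed.

Definition payoff u i (m : profile) : R := exp_util u i (outcome m).

Lemma exp_utilD (c : R) u i (y : Z -> R) : \sum_z y z = 1 ->
  exp_util (fun i z => u i z + c) i y = exp_util u i y + c.
Proof.
move=> y1; rewrite /exp_util -[c in RHS]mul1r -y1 mulr_suml -big_split/=.
by apply: eq_bigr => z _; rewrite mulrDr.
Qed.

Lemma mixed_profile_dfwith lam i (mu : msg G i -> R) :
  mixed_profile lam -> mixed mu -> mixed_profile (dfwith lam mu).
Proof.
move=> lmix mumix j; have := dfwithP lam mu j.
by case: (dfwithP lam mu j) => // k ik _; exact: lmix.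
Qed.

(** Reduces arbitrary real utilities to nonnegative ones, which the expectation lemmas require. *)
Lemma MNE_shift (c : R) u lam : MNE u lam -> MNE (fun i z => u i z + c) lam.
Proof.
move=> [lmix br]; split=> // i mu mumix.
rewrite !exp_utilD ?lerD2r ?br//; apply: induced_total => //.
exact: mixed_profile_dfwith.
Qed.

Definition dirac (T : countType) (t : T) : T -> R := fun s => (s == t)%:R.

Lemma esum_dirac (T : countType) (t : T) (a : T -> \bar R) : (0 <= a t)%E ->
  (\esum_(s in [set: T]) ((dirac t s)%:E * a s) = a t)%E.
Proof.
move=> a0; rewrite (_ : esum _ _ = \esum_(s in [set t]%classic) a s)%E.
  by rewrite esum_set1.
rewrite [RHS]esum_mkcond; apply: eq_esum => s _; rewrite /dirac.
have [->|st] := eqVneq s t; first by rewrite mem_set// mul1e.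
by rewrite memNset ?mul0e//= => e; rewrite e eqxx in st.
Qed.

Lemma mixed_dirac (T : countType) (t : T) : mixed (dirac t).
Proof.
split=> [s|]; first by rewrite /dirac.
rewrite -[RHS](@esum_dirac _ t (fun=> 1%E))//.
by apply: eq_esum => s _; rewrite mule1.
Qed.

Lemma payoff_bounded u i : (forall z, 0 <= u i z) -> bounded_ge0 (payoff u i).
Proof. by move=> u0; exact: bounded_ge0_sum. Qed.

Lemma payoff_upd_bounded u i t : (forall z, 0 <= u i z) ->
  bounded_ge0 (fun m => payoff u i (upd m i t)).
Proof. by move=> /payoff_bounded[B FB]; exists B => m; exact: FB. Qed.

(** The payoff of a mixed deviation [mu] is the [mu]-average of the payoffs of pure ones; conversely
    a pure deviation is a Dirac mixture. *)
Lemma MNE_pure_deviation u lam : (forall i z, 0 <= u i z) ->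
  MNE u lam <-> mixed_profile lam /\
    forall i t, Ex lam (fun m => payoff u i (upd m i t)) <= Ex lam (payoff u i).
Proof.
move=> u0.
have dev (lmix : mixed_profile lam) i mu : mixed mu ->
    (exp_util u i (induced (dfwith lam mu)))%:E =
    (\esum_(t in [set: msg G i]) ((mu t)%:E * eexp lam (fun m => payoff u i (upd m i t))))%E.
  move=> mumix; have dmix := mixed_profile_dfwith lmix mumix.
  rewrite /exp_util (sum_induced dmix)// (EFin_Ex dmix); last exact: payoff_bounded.
  apply: eexp_dfwith => // m.
  by apply: sumr_ge0 => z _; rewrite mulr_ge0// outcome_ge0.
have pu0 i (t : msg G i) (lmix : mixed_profile lam) : (0 <= eexp lam (fun m => payoff u i (upd m i t)))%E.
  apply: (eexp_ge0 lmix) => m.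
  by apply: sumr_ge0 => z _; rewrite mulr_ge0// outcome_ge0.
split=> [[lmix br]|[lmix br]]; split=> //.
  move=> i t; have := br i _ (mixed_dirac t).
  rewrite -lee_fin dev//; last exact: mixed_dirac.
  rewrite esum_dirac ?pu0// -(EFin_Ex lmix) ?lee_fin; last exact: payoff_upd_bounded.
  by rewrite {1}/exp_util (sum_induced lmix).
move=> i mu mumix; rewrite -lee_fin dev// /exp_util (sum_induced lmix)//.
have [mu0 mu1] := mumix; set c := Ex _ _.
have c0 : 0 <= c.
  rewrite -(Ex_cst lmix (lexx 0)); apply: (ler_Ex lmix).
  - exact: bounded_ge0_cst.
  - exact: payoff_bounded.
  - by move=> m _; apply: sumr_ge0 => z _; rewrite mulr_ge0// outcome_ge0.
rewrite -[leRHS]mule1 -mu1 -ge0_esumZl//; apply: le_esum => t _.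
rewrite -(EFin_Ex lmix); last exact: payoff_upd_bounded.
by rewrite -!EFinM lee_fin mulrC ler_wpM2r// br.
Qed.

(* Deviating to the uniform [t] loses at most [e] on [s], the tail has mass at most [e],
   and a profitable deviation at [m0] would gain a fixed multiple of [prob lam m0]. *)
Lemma MNE_support_pure u lam : (forall i z, 0 <= u i z) -> MNE u lam ->
  (forall i (s : seq profile) (e : R), 0 < e -> exists t : msg G i,
     forall m t', m \in s -> payoff u i (upd m i t') <= payoff u i (upd m i t) + e) ->
  forall m, 0 < prob lam m ->
  forall i t, payoff u i (upd m i t) <= payoff u i m.
Proof.
move=> u0 /(MNE_pure_deviation _ u0)[lmix br] dom m0 pm0 i t0.
rewrite leNgt; apply/negP => gt0.
set d := payoff u i (upd m0 i t0) - payoff u i m0.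
have d0 : 0 < d by rewrite subr_gt0.
have [B FB] := payoff_bounded (u0 i).
have B0 : 0 <= B by have /andP[a /(le_trans a)] := FB m0.
(* Chosen so that the total loss [e + B * e] is half of the gain [d * prob lam m0]. *)
set e := d * prob lam m0 / (2 * (1 + B)).
have e0 : 0 < e by rewrite divr_gt0 ?mulr_gt0// ltr_pwDl.
have [s0 tail0] := Ex_tail lmix e0.
(* [m0] is adjoined so that [t] is nearly optimal there too, whether or not the tail bound covers
   it. *)
set s := m0 :: s0.
have tail : Ex lam (fun m => (m \notin s)%:R) <= e.
  apply: le_trans tail0; apply: (ler_Ex lmix); try exact: bounded_ge0_bool.
  move=> m _; rewrite inE negb_or ler_nat.
  by case: (m \notin s0); rewrite ?andbF ?andbT ?leq_b1.
have [t tdom] := dom i s _ e0.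
have b1 := payoff_bounded (u0 i).
have b2 := payoff_upd_bounded t (u0 i).
have b3 : bounded_ge0 (fun m : profile => B * (m \notin s)%:R).
  by apply: bounded_ge0Z => //; exact: bounded_ge0_bool.
have b4 := bounded_ge0_cst _ (ltW e0).
have b5 : bounded_ge0 (fun m : profile => d * (m == m0)%:R).
  by apply: bounded_ge0Z; [exact: ltW|exact: bounded_ge0_bool].
have : Ex lam (fun m => payoff u i m + d * (m == m0)%:R) <=
       Ex lam (fun m => payoff u i (upd m i t) + (e + B * (m \notin s)%:R)).
  apply: (ler_Ex lmix); [exact: bounded_ge0D|by do 2?apply: bounded_ge0D|].
  move=> m _; have [->|mm0] := eqVneq m m0.
    have := tdom m0 t0 (mem_head _ _); rewrite /s mem_head/= /d; lra.
  rewrite mulr0 addr0; have [ms|ms] := boolP (m \in s).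
    by rewrite mulr0 addr0 -{1}(upd_id m i) tdom.
  have /andP[_ ?] := FB m; have /andP[? _] := FB (upd m i t); rewrite /=; lra.
rewrite !(ExD lmix)//; last by apply: bounded_ge0D.
rewrite (ExZ lmix) ?(ltW d0)//; last exact: bounded_ge0_bool.
rewrite (ExZ lmix)//; last exact: bounded_ge0_bool.
rewrite (Ex_cst lmix (ltW e0)) (Ex_point lmix).
have := br i t; have : B * Ex lam (fun m => (m \notin s)%:R) <= B * e by rewrite ler_wpM2l.
have eE : e * (1 + B) * 2 = d * prob lam m0.
  by rewrite /e; field; rewrite gt_eqF// ltr_pwDl.
have : 0 < d * prob lam m0 by rewrite mulr_gt0.
lra.
Qed.

End Games.
(* For each state and agent, [W th i] is the set of outcomes which [i] can reach against
   an equilibrium whose outcome is [f th]. *)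
Record deviation_witness (n : nat) (Z Theta : finType)
    (pref : Theta -> 'I_n -> rel Z) (f : Theta -> Z)
    (W : Theta -> 'I_n -> {set Z}) : Prop := DeviationWitness {
  witness_mem : forall th i, f th \in W th i;
  witness_below : forall th i,
    (exists2 z, z \in W th i & ~~ pref th i z (f th)) \/
    {in W th i, forall z, pref th i (f th) z};
  witness_reversal : forall th th', f th <> f th' ->
    exists i x z, [/\ x \in W th i, z \in W th i, ~~ pref th' i (f th) x &
      (pref th i (f th) z && ~~ pref th' i (f th) z) ||
      (~~ pref th i z (f th) && pref th' i z (f th))];
  witness_unanimous : forall th th' i,
    (forall j z w, j != i -> z \in W th i -> pref th' j z w) ->
    {in W th i &, forall z w, pref th' i z w} ->
    {in W th i, forall z, z = f th'} }.

(** * Rank utilities and the ordinal conditions that implementation forces *)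

Section Rank.
Variables (Z : finType) (r : rel Z).
Hypothesis r_preorder : complete_preorder r.

(** A representation with values at most [#|Z|]; this bound supplies the multiplier [C] in
    [deviation_witness_of_nat]. *)
Definition rank (z : Z) : nat := #|[set w | r z w]|.

Lemma rankP z z' : r z z' <-> (rank z' <= rank z)%N.
Proof.
have [tot tr] := r_preorder; split=> [zz'|].
  by apply/subset_leq_card/fintype.subsetP => w; rewrite !inE; exact: tr.
apply: contraTT => nzz'; rewrite -ltnNge; apply: proper_card.
have z'z : r z' z by have := tot z z'; rewrite (negPf nzz').
apply/properP; split.
  by apply/fintype.subsetP => w; rewrite !inE; exact: tr.
by exists z'; rewrite !inE ?(negPf nzz')//; have := tot z' z'; rewrite orbb.
Qed.

Lemma rank_le z : (rank z <= #|Z|)%N. Proof. exact: max_card. Qed.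

End Rank.

Section Necessity.
Variables (R : realType) (n : nat) (Z Theta : finType).
Variables (pref : Theta -> 'I_n -> rel Z) (f : Theta -> Z).
Hypothesis pref_preorder : forall th i, complete_preorder (pref th i).
Variable G : mechanism R n Z.
Local Notation profile := {dffun forall i, msg G i}.

(** Natural utilities are rational and nonnegative, and comparisons between them can be left to
    [lia]. *)
Definition natu (v : 'I_n -> Z -> nat) (i : 'I_n) (z : Z) : R := (v i z)%:R.

Lemma natu_ge0 v i z : 0 <= natu v i z. Proof. exact: ler0n. Qed.
Local Hint Resolve natu_ge0 : core.

Definition reach (lam : forall i, msg G i -> R) (i : 'I_n) : {set Z} :=
  [set z | `[< exists (m : profile) t, 0 < prob lam m /\ 0 < outcome (upd m i t) z >]].

Lemma reachI lam (m : profile) i t z :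
  0 < prob lam m -> 0 < outcome (upd m i t) z -> z \in reach lam i.
Proof. by move=> pm oz; rewrite inE; apply/asboolP; exists m, t. Qed.

Section Equilibrium.
Variables (lam : forall i, msg G i -> R) (x : Z).
Arguments lam : clear implicits.
Hypothesis lmix : mixed_profile lam.
Hypothesis lam_x : forall z, 0 < induced lam z <-> z = x.

Lemma outcome_support (m : profile) z : 0 < prob lam m -> 0 < outcome m z -> z = x.
Proof. by move=> pm om; apply/lam_x/(induced_gt0P _ lmix); exists m. Qed.

Lemma payoff_support u i (m : profile) : 0 < prob lam m -> payoff u i m = u i x.
Proof.
move=> pm; apply/eqP; rewrite eq_le; apply/andP; split.
  by apply: (exp_util_le (outcome_lottery _)) => z /(outcome_support pm) ->.
by apply: (le_exp_util (outcome_lottery _)) => z /(outcome_support pm) ->.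
Qed.

Lemma reach_mem i : x \in reach lam i.
Proof.
have /(induced_gt0P _ lmix)[m [pm om]] : 0 < induced lam x by apply/lam_x.
by apply: (@reachI _ m i (m i)) => //; rewrite upd_id.
Qed.

Lemma Ex_payoff_support v i : Ex lam (payoff (natu v) i) = natu v i x.
Proof.
rewrite -[RHS](Ex_cst lmix)//; apply/eqP; rewrite eq_le.
by apply/andP; split; apply: (ler_Ex lmix);
  rewrite ?(payoff_bounded (natu_ge0 v i))//; try exact: bounded_ge0_cst;
  try exact: payoff_bounded; move=> m pm; rewrite payoff_support.
Qed.

(** Either the gain over [x] under [v'] is at most [C] times the gain under [v], whose expectation
    is not positive in equilibrium, or no reachable outcome beats [x]. Differences are written as
    sums because subtraction on [nat] truncates. *)
Lemma MNE_transfer (v v' : 'I_n -> Z -> nat) (C : nat) : MNE (natu v) lam ->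
  (forall i, {in reach lam i, forall z, v' i z + C * v i x <= C * v i z + v' i x}%N \/
             {in reach lam i, forall z, v' i z <= v' i x}%N) ->
  MNE (natu v') lam.
Proof.
move=> /(MNE_pure_deviation _ (natu_ge0 v))[_ br] vv'.
apply/(MNE_pure_deviation _ (natu_ge0 v')); split=> // i t.
rewrite Ex_payoff_support; have [{}vv'|{}vv'] := vv' i; last first.
  rewrite -[leRHS](Ex_cst lmix)//; apply: (ler_Ex lmix).
  - exact: payoff_upd_bounded.
  - exact: bounded_ge0_cst.
  - move=> m pm; apply: (exp_util_le (outcome_lottery _)) => z oz.
    by rewrite ler_nat vv'//; exact: reachI oz.
have := br i t; rewrite Ex_payoff_support => bri.
have bv := payoff_upd_bounded t (natu_ge0 v i).
have bv' := payoff_upd_bounded t (natu_ge0 v' i).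
have C0 : 0 <= C%:R :> R by exact: ler0n.
have bx := bounded_ge0_cst _ (natu_ge0 v' i x).
have bCx := bounded_ge0_cst _ (mulr_ge0 C0 (natu_ge0 v i x)).
have : Ex lam (fun m => payoff (natu v') i (upd m i t) + C%:R * natu v i x) <=
       Ex lam (fun m => C%:R * payoff (natu v) i (upd m i t) + natu v' i x).
  apply: (ler_Ex lmix); [exact: bounded_ge0D|by apply: bounded_ge0D => //; exact: bounded_ge0Z|].
  move=> m pm; rewrite /payoff /exp_util.
  have cst K : K = \sum_z outcome (upd m i t) z * K.
    by rewrite -mulr_suml outcome_sum mul1r.
  rewrite [X in _ + X <= _]cst [X in _ <= _ + X]cst mulr_sumr -!big_split/=.
  apply: ler_sum => z _.
  have := outcome_ge0 (upd m i t) z; rewrite le_eqVlt => /predU1P[<-|o0].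
    by rewrite !mul0r !mulr0.
  rewrite -mulrDr mulrCA -mulrDr ler_wpM2l ?(ltW o0)//.
  by rewrite /natu -!natrM -!natrD ler_nat vv'//; exact: reachI o0.
have bCv := bounded_ge0Z C0 bv.
rewrite !(ExD lmix)// !(ExZ lmix)//; last exact: bounded_ge0_cst.
rewrite !(Ex_cst lmix)//.
have : C%:R * Ex lam (fun m => payoff (natu v) i (upd m i t)) <= C%:R * natu v i x.
  exact: ler_wpM2l.
lra.
Qed.

(** A message that reaches a strictly better outcome at one profile of the support never loses at
    the others, so it would be a profitable deviation. *)
Lemma reach_below (v : 'I_n -> Z -> nat) (i : 'I_n) : MNE (natu v) lam ->
  {in reach lam i, forall z, v i x <= v i z}%N ->
  {in reach lam i, forall z, v i z <= v i x}%N.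
Proof.
move=> /(MNE_pure_deviation _ (natu_ge0 v))[_ br] ge z0.
rewrite inE => /asboolP[m0 [t [pm0 oz0]]].
rewrite leqNgt; apply/negP => lt.
have bv := payoff_upd_bounded t (natu_ge0 v i).
have bx := bounded_ge0_cst _ (natu_ge0 v i x).
set d := payoff (natu v) i (upd m0 i t) - natu v i x.
have d0 : 0 < d.
  rewrite subr_gt0 -[X in X < _]mul1r -(outcome_sum (upd m0 i t)) mulr_suml.
  rewrite /payoff /exp_util (bigD1 z0)//= [X in _ < X](bigD1 z0)//=.
  apply: ltr_leD; first by rewrite ltr_pM2l// ltr_nat.
  apply: ler_sum => z _.
  have := outcome_ge0 (upd m0 i t) z; rewrite le_eqVlt => /predU1P[<-|o0].
    by rewrite !mul0r.
  by rewrite ler_wpM2l ?(ltW o0)// ler_nat ge//; exact: reachI o0.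
have bd : bounded_ge0 (fun m : profile => d * (m == m0)%:R).
  by apply: bounded_ge0Z; [exact: ltW|exact: bounded_ge0_bool].
have : Ex lam (fun m => natu v i x + d * (m == m0)%:R) <=
       Ex lam (fun m => payoff (natu v) i (upd m i t)).
  apply: (ler_Ex lmix) => //; first exact: bounded_ge0D.
  move=> m pm; have [->|mm0] := eqVneq m m0; first by rewrite mulr1 /d addrC subrK.
  rewrite mulr0 addr0; apply: (le_exp_util (outcome_lottery _)) => z oz.
  by rewrite ler_nat ge//; exact: reachI oz.
rewrite (ExD lmix)// (Ex_cst lmix)// (ExZ lmix) ?(ltW d0) ?(Ex_point lmix)//; last exact: bounded_ge0_bool.
have := br i t; rewrite Ex_payoff_support.
have : 0 < d * prob lam m0 by rewrite mulr_gt0.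
lra.
Qed.

(** Let [i] switch to a message that reaches [z]. The others then receive only outcomes that are
    best for them, and [i] is indifferent among all that is reachable, so this is again an
    equilibrium. *)
Lemma reach_unanimous (v : 'I_n -> Z -> nat) (i : 'I_n) z :
  (forall j z w, j != i -> z \in reach lam i -> v j w <= v j z)%N ->
  {in reach lam i &, forall z w, v i w <= v i z}%N ->
  z \in reach lam i ->
  exists lam' : forall i, msg G i -> R, MNE (natu v) lam' /\ 0 < induced lam' z.
Proof.
move=> top ind; rewrite inE => /asboolP[m0 [t0 [pm0 oz]]].
have l0 j s : 0 <= lam j s by case: (lmix j).
pose lam' : forall i, msg G i -> R := dfwith lam (dirac R t0).
have mix' : mixed_profile lam' by apply: mixed_profile_dfwith => //; exact: mixed_dirac.
have pE m : prob lam' m = (m i == t0)%:R * \prod_(j | j != i) lam j (m j).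
  rewrite (prob_bigD1 _ _ i) /lam' dfwith_in; congr (_ * _).
  by apply: eq_bigr => j ji; rewrite dfwith_out// eq_sym.
have supp m t : 0 < prob lam' m -> forall w, 0 < outcome (upd m i t) w -> w \in reach lam i.
  rewrite pE => pm w; have [s s0] := mixed_gt0 (lmix i).
  have pm' : 0 < prob lam (upd m i s).
    rewrite (prob_bigD1 _ _ i) upd_in prod_upd mulr_gt0//.
    by move: pm; case: (m i == t0); rewrite ?mul1r ?mul0r ?ltxx.
  by move=> ow; apply: (reachI (t := t) pm'); rewrite upd_upd.
exists lam'; split; last first.
  apply/(induced_gt0P _ mix'); exists (upd m0 i t0); split=> //.
  rewrite pE upd_in eqxx mul1r prod_upd.
  have : 0 <= \prod_(j | j != i) lam j (m0 j) by apply: prodr_ge0.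
  rewrite le_eqVlt => /predU1P[e|//].
  by move: pm0; rewrite (prob_bigD1 _ _ i) -e mulr0 ltxx.
apply/(MNE_pure_deviation _ (natu_ge0 v)); split=> // j t.
(* [x] is itself reachable, so its utility separates the deviation payoff from the equilibrium
   payoff. *)
apply: (@le_trans _ _ (natu v j x)).
  rewrite -[leRHS](Ex_cst mix')//; apply: (ler_Ex mix').
  - exact: payoff_upd_bounded.
  - exact: bounded_ge0_cst.
  - move=> m pm; apply: (exp_util_le (outcome_lottery _)) => w ow; rewrite ler_nat.
    have [ji|ji] := eqVneq j i; last by apply: top => //; exact: reach_mem.
    by subst j; apply: ind; [exact: reach_mem|exact: supp ow].
rewrite -[leLHS](Ex_cst mix')//; apply: (ler_Ex mix').
- exact: bounded_ge0_cst.
- exact: payoff_bounded.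
- move=> m pm; apply: (le_exp_util (outcome_lottery _)) => w ow; rewrite ler_nat.
  have wr : w \in reach lam i by apply: (supp m (m i)); rewrite ?upd_id.
  have [ji|ji] := eqVneq j i; last exact: top.
  by subst j; apply: ind => //; exact: reach_mem.
Qed.

End Equilibrium.

Lemma deviation_witness_of_nat :
  (forall th v, (forall i z z', pref th i z z' <-> (v i z' <= v i z)%N) ->
     MNE_support_is G (natu v) (f th)) ->
  exists W, deviation_witness pref f W.
Proof.
move=> impl.
pose v th i z := rank (pref th i) z.
have vP th i z z' : pref th i z z' <-> (v th i z' <= v th i z)%N by exact: rankP.
have eq th : exists lam : forall i, msg G i -> R, MNE (natu (v th)) lam /\ forall z, 0 < induced lam z <-> z = f th.
  have [_ /(_ erefl)[lam [mne pos]]] := impl th _ (vP th) (f th).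
  exists lam; split=> // z; split=> [zp|->//].
  by apply/(impl th _ (vP th) z); exists lam.
pose lam th := sval (cid (eq th)).
have lamP th : MNE (natu (v th)) (lam th) /\ forall z, 0 < induced (lam th) z <-> z = f th.
  by rewrite /lam; case: cid.
have lmix th : mixed_profile (lam th) by have [[]] := lamP th.
have sup th := (lamP th).2.
exists (fun th i => reach (lam th) i); split.
- by move=> th i; exact: reach_mem.
- move=> th i; have [ex|nex] := pselect (exists2 z, z \in reach (lam th) i & ~~ pref th i z (f th)).
    by left.
  right=> z zr; apply/vP; move: z zr; apply: reach_below (sup th) _ _ _ _ => //; first by case: (lamP th).
  move=> z zr; apply/vP; apply: contrapT => nz; apply: nex; exists z => //; exact/negP.
- move=> th th' ff'; apply: contrapT => nex; apply: ff'.
  pose C := #|Z|.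
  (* Still represents [th'], but gaps below [f th] are stretched: a better outcome gains at most
     [C], a worse one loses more than [C * C]. Hence [C] times the ranks at [th] can dominate
     both. *)
  pose v' i z := (C * C * minn (v th' i z) (v th' i (f th)) + v th' i z)%N.
  have v'P i z z' : pref th' i z z' <-> (v' i z' <= v' i z)%N.
    split=> [/vP le|]; last first.
      move=> le; apply/vP; rewrite leqNgt; apply/negP => lt.
      move: le; apply/negP; rewrite -ltnNge.
      rewrite /v' -addnS leq_add// leq_mul2l leq_min !geq_min.
      by rewrite (ltnW lt) leqnn orbT orbT.
    by rewrite /v' leq_add// leq_mul2l leq_min !geq_min le leqnn orbT orbT.
  (* If the equilibrium chosen for [th] survives at [th'], then its outcome [f th] must be
     [f th']. *)
  apply/(impl th' _ v'P); exists (lam th); split; last by apply/sup.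
  apply: (MNE_transfer (C := C) (lmix th) (sup th) (lamP th).1) => i.
  have [all|nall] := pselect {in reach (lam th) i, forall z, pref th' i (f th) z}.
    by right=> z zr; apply/v'P; exact: all.
  left=> z zr.
  (* This [w] serves as the outcome [x] of a reversal, so the absence of a reversal constrains every
     reachable [z]. *)
  have [w wr nw] : exists2 w, w \in reach (lam th) i & ~~ pref th' i (f th) w.
    apply: contrapT => nw; apply: nall => w wr; apply: contrapT => nwf.
    by apply: nw; exists w => //; exact/negP.
  have {}nex : ~ ((pref th i (f th) z && ~~ pref th' i (f th) z) ||
      (~~ pref th i z (f th) && pref th' i z (f th))).
    by move=> h; apply: nex; exists i, w, z; split.
  move/negP: nex; rewrite negb_or !negb_and !negbK.
  have vC th1 y : (v th1 i y <= C)%N by exact: rank_le.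
  have := vC th z; have := vC th (f th); have := vC th' z; have := vC th' (f th).
  have C0 : (0 < C)%N by apply/card_gt0P; exists z.
  have eqb th1 y y' : pref th1 i y y' = (v th1 i y' <= v th1 i y)%N.
    by apply/idP/idP => /vP.
  rewrite /v' !eqb; move: (v th i z) (v th i (f th)) (v th' i z) (v th' i (f th)).
  move=> a b a' b' hb' ha' hb ha /andP[h1 h2].
  rewrite minnn; have [ab|ba|e] := ltngtP a b.
  - have lt : (a' < b')%N by move: h2; lia.
    rewrite (minn_idPl (ltnW lt)).
    have : (C * C * a'.+1 <= C * C * b')%N by rewrite leq_mul2l lt orbT.
    have : (C * b <= C * C)%N by rewrite leq_mul2l hb orbT.
    lia.
  - have : (C * C * minn a' b' <= C * C * b')%N by rewrite leq_mul2l geq_minr orbT.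
    have : (C * b.+1 <= C * a)%N by rewrite leq_mul2l ba orbT.
    lia.
  - have le : (a' <= b')%N by move: h1; lia.
    have : (C * C * minn a' b' <= C * C * b')%N by rewrite leq_mul2l geq_minr orbT.
    rewrite e; lia.
- move=> th th' i top ind z zr.
  have vP' := vP th'.
  apply/(impl th' _ (vP th')).
  apply: (reach_unanimous (lmix th) (sup th) _ _ zr).
  + by move=> j y w ji yr; apply/vP; exact: top.
  + by move=> y w yr wr; apply/vP; exact: ind.
Qed.

End Necessity.

(** * Lotteries with vanishing perturbations *)

Lemma eventually_forall (T : finType) (P : T -> nat -> Prop) :
  (forall t, exists k0, forall k, (k0 <= k)%N -> P t k) -> exists k, forall t, P t k.
Proof.
by move=> /choice[k0 k0P]; exists (\max_t k0 t)%N => t; apply: k0P; exact: leq_bigmax.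
Qed.

Section Mixtures.
Variables (R : realType) (n : nat) (Z : finType).
Implicit Types (u : 'I_n -> Z -> R) (y : Z -> R).

Definition eps (k : nat) : R := k.+1%:R^-1.

Lemma eps_gt0 k : 0 < eps k. Proof. by rewrite invr_gt0 ltr0n. Qed.

Lemma eps_le1 k : eps k <= 1.
Proof. by rewrite invf_le1 ?ltr0n// ler1n. Qed.

Lemma eps_small (B e : R) : 0 < e ->
  exists k0, forall k, (k0 <= k)%N -> eps k * B <= e.
Proof.
move=> e0; have [k0 hk0] : exists k0 : nat, B / e <= k0%:R.
  exists (Num.truncn (Num.max 0 (B / e))).+1.
  apply: le_trans (ltW (Num.Theory.truncnS_gt _)).
  by rewrite le_max lexx orbT.
exists k0 => k kk0; rewrite mulrC ler_pdivrMr ?ltr0n//.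
rewrite ler_pdivrMr// in hk0; apply: le_trans hk0 _.
by rewrite mulrC ler_wpM2l ?(ltW e0)// ler_nat (leq_trans kk0).
Qed.

(** The perturbation [b] fades as [k] grows. In this way a payoff that large bids only approach
    still bounds an equilibrium payoff from below. *)
Lemma eps_lim (k0 : nat) (a b c : R) :
  (forall k, (k0 <= k)%N -> (1 - eps k) * a + eps k * b <= c) -> a <= c.
Proof.
move=> h; rewrite leNgt; apply/negP => ca.
have e0 : 0 < (a - c) / 2 by rewrite divr_gt0 ?subr_gt0.
have [k1 /(_ _ (leq_maxr k0 k1))] := eps_small (a - b) e0.
by have := h _ (leq_maxl k0 k1); lra.
Qed.

Definition point_mass (z : Z) : Z -> R := fun w => (w == z)%:R.
Definition mix (k : nat) y y' : Z -> R := fun w => (1 - eps k) * y w + eps k * y' w.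
Definition average (T : finType) (A : {set T}) (F : T -> Z -> R) : Z -> R :=
  fun w => (\sum_(t in A) F t w) / #|A|%:R.

Lemma lottery_point_mass z : lottery (point_mass z).
Proof.
split=> [w|]; first by rewrite ler0n.
by rewrite (bigD1 z)//= big1 /point_mass ?eqxx ?addr0// => w /negPf ->.
Qed.

Lemma lottery_mix k y y' : lottery y -> lottery y' -> lottery (mix k y y').
Proof.
move=> [y0 y1] [y'0 y'1]; split=> [w|].
  by rewrite addr_ge0// mulr_ge0// ?(ltW (eps_gt0 k))// subr_ge0 eps_le1.
by rewrite big_split/= -!mulr_sumr y1 y'1; ring.
Qed.

Lemma lottery_average (T : finType) (A : {set T}) F : (0 < #|A|)%N ->
  (forall t, t \in A -> lottery (F t)) -> lottery (average A F).
Proof.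
move=> A0 Fl; split=> [w|].
  by rewrite divr_ge0// sumr_ge0// => t At; have [] := Fl t At.
rewrite -mulr_suml exchange_big/= (eq_bigr (fun=> 1)); last by move=> t /Fl[].
by rewrite sumr_const divff// pnatr_eq0 -lt0n.
Qed.

Lemma exp_util_point_mass u i z : exp_util u i (point_mass z) = u i z.
Proof.
rewrite /exp_util (bigD1 z)//= big1 /point_mass ?eqxx ?mul1r ?addr0// => w /negPf ->.
by rewrite mul0r.
Qed.

Lemma exp_util_mix u i k y y' : exp_util u i (mix k y y') =
  (1 - eps k) * exp_util u i y + eps k * exp_util u i y'.
Proof.
rewrite /exp_util !mulr_sumr -big_split/=; apply: eq_bigr => z _.
by rewrite /mix; ring.
Qed.

Lemma exp_util_average u i (T : finType) (A : {set T}) F :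
  exp_util u i (average A F) = (\sum_(t in A) exp_util u i (F t)) / #|A|%:R.
Proof.
rewrite /exp_util exchange_big/= mulr_suml; apply: eq_bigr => z _.
by rewrite /average mulrAC mulr_suml.
Qed.

Lemma mix_gt0r k y y' z : lottery y -> 0 < y' z -> 0 < mix k y y' z.
Proof.
move=> [y0 _] yz; rewrite ltr_wpDl ?mulr_gt0 ?eps_gt0//.
by rewrite mulr_ge0// subr_ge0 eps_le1.
Qed.

Lemma mix_gt0 k y y' z : lottery y -> lottery y' -> 0 < mix k y y' z ->
  0 < y z \/ 0 < y' z.
Proof.
move=> [y0 _] [y'0 _].
have := y0 z; rewrite /mix le_eqVlt => /predU1P[<-|]; last by left.
have := y'0 z; rewrite /mix le_eqVlt => /predU1P[<-|]; last by right.
by rewrite !mulr0 addr0 ltxx.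
Qed.

Lemma point_mass_gt0 z w : 0 < point_mass z w -> w = z.
Proof. by rewrite /point_mass; case: eqP => //; rewrite ltxx. Qed.

Lemma average_gt0 (T : finType) (A : {set T}) F t z :
  (forall t, t \in A -> lottery (F t)) -> t \in A -> 0 < F t z -> 0 < average A F z.
Proof.
move=> Fl At Fz; rewrite divr_gt0//.
  by rewrite (bigD1 t)//= ltr_wpDr// sumr_ge0// => s /andP[/Fl[]].
by rewrite ltr0n; apply/card_gt0P; exists t.
Qed.

Lemma average_gt0_ex (T : finType) (A : {set T}) F z :
  (forall t, t \in A -> lottery (F t)) -> 0 < average A F z ->
  exists2 t, t \in A & 0 < F t z.
Proof.
move=> Fl av; apply: contrapT => nex; move: av.
rewrite /average big1 ?mul0r ?ltxx// => t At.
apply/eqP; rewrite eq_le; have [-> _] := Fl t At; rewrite andbT leNgt.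
by apply/negP => Ftz; apply: nex; exists t.
Qed.

Lemma exp_util_average_le u i (T : finType) (A : {set T}) F (K : R) :
  (0 < #|A|)%N -> (forall t, t \in A -> exp_util u i (F t) <= K) ->
  exp_util u i (average A F) <= K.
Proof.
move=> A0 FK; rewrite exp_util_average ler_pdivrMr ?ltr0n// mulr_natr -sumr_const.
exact: ler_sum.
Qed.

(** One term below [K] would pull the average below [K]. *)
Lemma exp_util_average_max u i (T : finType) (A : {set T}) F (K : R) :
  (forall t, t \in A -> exp_util u i (F t) <= K) -> K <= exp_util u i (average A F) ->
  forall t, t \in A -> exp_util u i (F t) = K.
Proof.
move=> FK Kav t At; apply/eqP; rewrite eq_le FK//= leNgt; apply/negP => lt.
move: Kav; rewrite leNgt => /negP; apply.
have A0 : (0 < #|A|)%N by apply/card_gt0P; exists t.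
rewrite exp_util_average ltr_pdivrMr ?ltr0n// mulr_natr -sumr_const.
rewrite (bigD1 t)//= [X in _ < X](bigD1 t)//=.
by apply: ltr_leD => //; apply: ler_sum => s /andP[/FK].
Qed.

End Mixtures.
Arguments point_mass {R Z} z w.

(** * The integer-game mechanism and its pure equilibria *)

Section CanonicalMechanism.
Variables (R : realType) (n : nat) (Z Theta : finType).
Variables (pref : Theta -> 'I_n -> rel Z) (f : Theta -> Z).
Variable W : Theta -> 'I_n -> {set Z}.
Hypothesis n3 : (3 <= n)%N.
Hypothesis pref_preorder : forall th i, complete_preorder (pref th i).
Hypothesis Wit : deviation_witness pref f W.

(* [inl (th, k)] announces the state and an index [k]; [inr (r, z, pl)] is a bid [r] with
   the outcome [z] wanted in the integer game and, for each [k] and each state, a pair of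
   reachable outcomes wanted when all others announce that state and [k]. *)
Definition message : countType :=
  (Theta * nat + nat * Z * seq {ffun Theta -> Z * Z})%type.

Implicit Types (x : message) (m : {dffun forall i : 'I_n, message}).

Definition bid x : nat := if x is inr (r, _, _) then r else 0%N.
Definition wish x : Z :=
  match x with inl (th, _) => f th | inr (_, z, _) => z end.
Definition plan x : seq {ffun Theta -> Z * Z} := if x is inr (_, _, pl) then pl else [::].

Definition option_lottery (k : nat) (p : Z * Z) : Z -> R :=
  mix k (point_mass p.1) (point_mass p.2).

(* For [k] large, these lotteries are no better than [f th] for agent [i] at [th]. *)
Definition options (th : Theta) (i : 'I_n) : {set Z * Z} :=
  [set p | [&& p.1 \in W th i, p.2 \in W th i &
     ~~ pref th i p.1 (f th) || (pref th i (f th) p.1 && pref th i (f th) p.2)]].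

(** The default [(f th, f th)] covers plans that are too short and pairs that are not allowed, so
    the result is always an option. *)
Definition chosen th i k x : Z * Z :=
  let p := nth (f th, f th) [seq (g : {ffun Theta -> Z * Z}) th | g <- plan x] k in
  if p \in options th i then p else (f th, f th).

(** The average keeps positive weight at every bid. Hence an optimal dissent requires indifference
    among all options, and every outcome of [W th i] stays in the support. At bid 0, in particular
    for announcements, only the average remains. *)
Definition dissent th i k x : Z -> R :=
  mix (bid x) (option_lottery k (chosen th i k x)) (average (options th i) (option_lottery k)).

Definition announced x : option (Theta * nat) := if x is inl p then Some p else None.

(** The common announcement of all agents other than [i], read off one of them and checked on the
    rest. *)
Definition agreed m (i : 'I_n) : option (Theta * nat) :=
  if [pick j | j != i] is Some j then
    if announced (m j) is Some p then
      if [forall l, (l != i) ==> (m l == inl p)] then Some p else None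
    else None
  else None.

Let i0 : 'I_n := Ordinal (ltn_trans (isT : 0 < 2)%N n3).

Definition uniform : Z -> R := average [set: Z] point_mass.

(** Ties are broken by [arg max]; the arguments below only use bids strictly above all others. The
    uniform part gives full support. *)
Definition integer_game m : Z -> R :=
  let x := m [arg max_(j > i0) bid (m j)]%N in
  mix (bid x) (point_mass (wish x)) uniform.

Definition canonical_outcome m : Z -> R :=
  if [pick i | agreed m i] is Some i then
    if agreed m i is Some (th, k) then
      if m i == inl (th, k) then point_mass (f th) else dissent th i k (m i)
    else integer_game m
  else integer_game m.

(** Three agents are what makes a dissenter identifiable: two candidate dissenters leave a third
    agent who witnesses the announcement. *)
Lemma exists_other2 (i j : 'I_n) : exists l, (l != i) && (l != j).
Proof.
have [l|none] := pickP (fun l => (l != i) && (l != j)); first by exists l.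
have : (#|'I_n| <= #|[set i; j]|)%N.
  apply: subset_leq_card; apply/fintype.subsetP => l _.
  by have /negbT := none l; rewrite negb_and !negbK !inE.
by rewrite card_ord cards2; case: (i != j) => /(leq_trans n3).
Qed.

Lemma agreedP m i p : reflect (forall j, j != i -> m j = inl p) (agreed m i == Some p).
Proof.
rewrite /agreed; case: pickP => [j ji|none]; last first.
  by exfalso; have [l /andP[li _]] := exists_other2 i i; have := none l; rewrite li.
apply: (iffP eqP) => [|all].
  case: (announced _) => // q; case: ifP => // /forallP all [<-] l li.
  by have := all l; rewrite li => /eqP.
rewrite all//= ifT//; apply/forallP => l; apply/implyP => li; exact/eqP/all.
Qed.

Lemma agreed_upd m i t : agreed (upd m i t) i = agreed m i.
Proof.
have eq p : (agreed (upd m i t) i == Some p) = (agreed m i == Some p).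
  by apply/agreedP/agreedP => all j ji; have := all j ji; rewrite upd_out// eq_sym.
case E : (agreed m i) => [p|]; first by apply/eqP; rewrite eq E.
by case E' : (agreed _ _) => [p|//]; have := eq p; rewrite E E' eqxx.
Qed.

Lemma agreed_None m i j : j != i -> announced (m j) = None -> agreed m i = None.
Proof.
move=> ji mj; case E : (agreed m i) => [p|//].
by move/eqP/agreedP/(_ j ji): E mj => ->.
Qed.

(** The outcome does not depend on the agent picked in [canonical_outcome]: for two candidates a
    third agent forces the same announcement, and if they differ then both have made it
    themselves. *)
Lemma outcome_agree m i th k : agreed m i = Some (th, k) ->
  canonical_outcome m =
  if m i == inl (th, k) then point_mass (f th) else dissent th i k (m i).
Proof.
move=> ag; have all := elimT (agreedP m i (th, k)) (introT eqP ag).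
rewrite /canonical_outcome; case: pickP => [i'|none]; last by have := none i; rewrite ag.
case E : (agreed m i') => [[th' k']|//] _.
have all' := elimT (agreedP m i' (th', k')) (introT eqP E).
have [l /andP[li li']] := exists_other2 i i'.
have [e1 e2] : (th', k') = (th, k) by have := all l li; rewrite all'// => -[-> ->].
subst th' k'; have [->//|ii'] := eqVneq i i'.
have -> : m i' = inl (th, k) by apply: all; rewrite eq_sym.
by rewrite (all' i ii') !eqxx.
Qed.

Lemma outcome_disagree m : (forall i, agreed m i = None) ->
  canonical_outcome m = integer_game m.
Proof.
by move=> none; rewrite /canonical_outcome; case: pickP => [i|//]; rewrite none.
Qed.

Lemma options_f th i : (f th, f th) \in options th i.
Proof.
rewrite inE /= !(witness_mem Wit)/=; have [tot _] := pref_preorder th i.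
by have := tot (f th) (f th); rewrite orbb => ->; rewrite orbT.
Qed.

Lemma card_options th i : (0 < #|options th i|)%N.
Proof. by apply/card_gt0P; exists (f th, f th); exact: options_f. Qed.

Lemma chosen_options th i k x : chosen th i k x \in options th i.
Proof. by rewrite /chosen; case: ifP => // _; exact: options_f. Qed.

Lemma lottery_option k p : lottery (option_lottery k p).
Proof. by apply: lottery_mix; exact: lottery_point_mass. Qed.

Lemma lottery_options th i k : lottery (average (options th i) (option_lottery k)).
Proof. by apply: lottery_average => [|p _]; [exact: card_options|exact: lottery_option]. Qed.

Lemma lottery_dissent th i k x : lottery (dissent th i k x).
Proof. by apply: lottery_mix; [exact: lottery_option|exact: lottery_options]. Qed.

Lemma lottery_uniform (z : Z) : lottery uniform.
Proof.
apply: lottery_average => [|p _]; last exact: lottery_point_mass.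
by apply/card_gt0P; exists z; rewrite inE.
Qed.

Lemma lottery_integer_game m : lottery (integer_game m).
Proof.
apply: lottery_mix; first exact: lottery_point_mass.
by apply: lottery_uniform (wish (m i0)).
Qed.

Lemma lottery_canonical m : lottery (canonical_outcome m).
Proof.
rewrite /canonical_outcome; case: pickP => [i _|_]; last exact: lottery_integer_game.
case: (agreed m i) => [[th k]|]; last exact: lottery_integer_game.
by case: ifP => _; [exact: lottery_point_mass|exact: lottery_dissent].
Qed.

Definition canonical_mechanism : mechanism R n Z := Mechanism lottery_canonical.

Section Payoffs.
Variable u : 'I_n -> Z -> R.
Hypothesis u0 : forall i z, 0 <= u i z.
Local Notation U i m := (exp_util u i (canonical_outcome m)).
Local Notation profile := {dffun forall i : 'I_n, message}.

Let total (i : 'I_n) : R := \sum_z u i z.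

Let le_total i z : u i z <= total i.
Proof. by rewrite /total (bigD1 z)//= lerDl sumr_ge0. Qed.

Let exp_util_total i y : lottery y -> 0 <= exp_util u i y <= total i.
Proof. by move=> ly; rewrite (le_exp_util ly)// (exp_util_le ly). Qed.

(** A bid by [i] also destroys any agreement among the opponents of another agent, so the integer
    game is played and [i] wins it. *)
Lemma outcome_bid (m : profile) i r z pl : agreed m i = None ->
  (forall j, j != i -> (bid (m j) < r)%N) ->
  canonical_outcome (upd m i (inr (r, z, pl))) = mix r (point_mass z) uniform.
Proof.
move=> none lt; rewrite outcome_disagree; last first.
  move=> j; have [->|ji] := eqVneq j i; first by rewrite agreed_upd.
  by apply: (agreed_None (j := i)); rewrite 1?eq_sym// upd_in.
rewrite /integer_game; case: arg_maxnP => // w _ /(_ i isT).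
have [->|wi] := eqVneq w i; first by rewrite upd_in.
by rewrite /= upd_in upd_out 1?eq_sym//= leqNgt lt.
Qed.

Lemma outcome_dissent (m : profile) i th k r z pl : agreed m i = Some (th, k) ->
  canonical_outcome (upd m i (inr (r, z, pl))) = dissent th i k (inr (r, z, pl)).
Proof. by move=> ag; rewrite (outcome_agree (i := i) (th := th) (k := k)) ?agreed_upd// upd_in. Qed.

(** By ever larger bids [i] obtains [z] up to a vanishing perturbation. *)
Lemma game_best_response (m : profile) i z : agreed m i = None ->
  (forall t, U i (upd m i t) <= U i m) -> u i z <= U i m.
Proof.
move=> none br.
apply: (@eps_lim _ (\max_j bid (m j)).+1 _ (exp_util u i uniform)) => r lr.
have := br (inr (r, z, [::])).
rewrite outcome_bid// ?exp_util_mix ?exp_util_point_mass// => j _.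
by apply: leq_trans lr; rewrite ltnS (leq_bigmax j).
Qed.

Lemma dissent_best_response (m : profile) i th k p : agreed m i = Some (th, k) ->
  p \in options th i -> (forall t, U i (upd m i t) <= U i m) ->
  exp_util u i (option_lottery k p) <= U i m.
Proof.
move=> ag po br.
apply: (@eps_lim _ 0 _ (exp_util u i (average (options th i) (option_lottery k)))) => r _.
(* Length [k.+1] makes entry [k] of the plan available. *)
have := br (inr (r, f th, nseq k.+1 [ffun=> p])).
rewrite (outcome_dissent _ _ _ ag) exp_util_mix.
by rewrite /chosen /plan map_nseq nth_nseq ltnSn ffunE po.
Qed.

Let best i th k : Z * Z :=
  [arg max_(p > (f th, f th) in options th i) exp_util u i (option_lottery k p)]%O.

Let bestP i th k : best i th k \in options th i /\
  forall p, p \in options th i ->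
    exp_util u i (option_lottery k p) <= exp_util u i (option_lottery k (best i th k)).
Proof. by rewrite /best; case: arg_maxP => //; exact: options_f. Qed.

Lemma dissent_le i th k x :
  exp_util u i (dissent th i k x) <= exp_util u i (option_lottery k (best i th k)).
Proof.
have [_ max] := bestP i th k.
have le1 := max _ (chosen_options th i k x).
have le2 := exp_util_average_le (card_options th i) max.
rewrite exp_util_mix; set b := exp_util u i (option_lottery k (best i th k)) in le1 le2 *.
have e0 := ltW (eps_gt0 R (bid x)); have e1 := eps_le1 R (bid x).
have le3 : (1 - eps R (bid x)) * exp_util u i (option_lottery k (chosen th i k x)) <=
    (1 - eps R (bid x)) * b by rewrite ler_wpM2l// subr_ge0.
have := ler_wpM2l e0 le2; lra.
Qed.

Lemma exp_util_option_diag i k (z : Z) :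
  exp_util u i (option_lottery k (z, z)) = u i z.
Proof. by rewrite exp_util_mix !exp_util_point_mass; ring. Qed.

Lemma mix_le i r y y' : lottery y -> lottery y' ->
  exp_util u i y <= exp_util u i (mix r y y') + eps R r * total i.
Proof.
move=> ly ly'; rewrite exp_util_mix.
have /andP[_ a] := exp_util_total i ly; have /andP[b _] := exp_util_total i ly'.
have := ler_wpM2l (ltW (eps_gt0 R r)) a; have := mulr_ge0 (ltW (eps_gt0 R r)) b.
lra.
Qed.

(** Supplies the near-dominance that [MNE_support_pure] asks for: one message names the best wish
    and the best option for each state and index, and bids high enough for all of [s]. *)
Lemma dominant_message (z0 : Z) i (s : seq profile) (e : R) : 0 < e -> exists t : message,
  forall m t', m \in s -> U i (upd m i t') <= U i (upd m i t) + e.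
Proof.
move=> e0.
have [k0 small] := eps_small (total i) e0.
pose top := [arg max_(z > z0) u i z]%O.
have topP z : u i z <= u i top by rewrite /top; case: arg_maxP => // w _; apply.
pose index x := if x is inl (_, k) then k else 0%N.
(* The plan must cover every index announced in [s]; the bid [r] must exceed all bids in [s] and
   make the perturbation cost at most [e]. *)
pose N := (\max_(m <- s) \max_j index (m j)).+1.
pose r := maxn k0 (\max_(m <- s) \max_j bid (m j)).+1.
exists (inr (r, top, mkseq (fun k => [ffun th => best i th k]) N)) => m t' ms.
have er : eps R r * total i <= e by apply: small; exact: leq_maxl.
case ag : (agreed m i) => [[th k]|]; last first.
  rewrite outcome_bid//; last first.
    move=> j _; apply: (@leq_trans (\max_j bid (m j)).+1).
      by rewrite ltnS; exact: (leq_bigmax j).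
    apply: leq_trans (leq_maxr _ _); rewrite ltnS.
    exact: (@leq_bigmax_seq _ _ xpredT (fun m : profile => \max_j bid (m j))).
  apply: (@le_trans _ _ (u i top)); first by apply: (exp_util_le (lottery_canonical _)).
  rewrite -[leLHS](exp_util_point_mass u i).
  by apply: le_trans (mix_le i r (lottery_point_mass _ _) (lottery_uniform z0)) _; rewrite lerD2l.
have kN : (k < N)%N.
  have [l /andP[li _]] := exists_other2 i i.
  have ml := elimT (agreedP m i (th, k)) (introT eqP ag) l li.
  rewrite ltnS; apply: (@leq_trans (\max_j index (m j))); last first.
    exact: (@leq_bigmax_seq _ _ xpredT (fun m : profile => \max_j index (m j))).
  by apply: leq_trans (leq_bigmax l); rewrite ml.
rewrite (outcome_dissent _ _ _ ag).
have [bo max] := bestP i th k.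
apply: (@le_trans _ _ (exp_util u i (option_lottery k (best i th k)))).
  rewrite (outcome_agree (i := i) (th := th) (k := k)) ?agreed_upd// upd_in.
  case: ifP => _; last exact: dissent_le.
  rewrite exp_util_point_mass -(exp_util_option_diag i k (f th)).
  by apply: max; exact: options_f.
apply: le_trans (mix_le i r (lottery_option k _) (lottery_options th i k)) _.
rewrite /dissent /chosen /plan -map_comp (nth_map 0%N) ?size_iota// nth_iota//= ffunE bo.
by rewrite lerD2l.
Qed.

Section State.
Variable th' : Theta.
Hypothesis u_th' : represents (pref th') u.
Hypothesis f_nonconstant : (2 <= #|[set f th | th : Theta]|)%N.

(** Under total indifference [witness_unanimous] would give [f th = f th'] for every [th]. *)
Lemma nonindifferent : ~ forall i z w, pref th' i z w.
Proof.
move=> ind; suff : (#|[set f th | th : Theta]| <= #|[set f th']|)%N.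
  by rewrite cards1 leqNgt f_nonconstant.
apply: subset_leq_card; apply/fintype.subsetP => _ /imsetP[th _ ->]; rewrite inE; apply/eqP.
apply: (witness_unanimous Wit (i := i0) (th := th)) (witness_mem Wit th i0).
  by move=> *; exact: ind.
by move=> *; exact: ind.
Qed.

(** The equilibrium payoff is at least the utility of every outcome, so the lottery lives on the
    maximizers. *)
Lemma game_support_top (m : profile) i z : agreed m i = None ->
  (forall t, U i (upd m i t) <= U i m) -> 0 < canonical_outcome m z ->
  forall w, pref th' i z w.
Proof.
move=> none br oz w; apply/u_th'.
have le y := game_best_response y none br.
by rewrite (exp_util_max (lottery_canonical m) le _ oz).
Qed.

Lemma uniform_gt0 z : 0 < uniform z.
Proof.
apply: (average_gt0 (t := z)) => // [t _|].
  exact: lottery_point_mass.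
by rewrite /point_mass eqxx ltr01.
Qed.

Lemma option_gt0 k p z : 0 < option_lottery k p z -> z = p.1 \/ z = p.2.
Proof.
by case/mix_gt0; rewrite ?lottery_point_mass//; try exact: lottery_point_mass;
  move=> /point_mass_gt0; [left|right].
Qed.

(** The second component of an option varies freely next to a fixed strictly worse [z0]; when there
    is no such [z0], the diagonal pairs are options. Equal payoffs thus force constant utility on
    [W th i]. *)
Lemma options_indifferent th i k K :
  (forall p, p \in options th i -> exp_util u i (option_lottery k p) = K) ->
  {in W th i &, forall z w, pref th' i z w}.
Proof.
move=> opK; suff [c cE] : exists c, {in W th i, forall z, u i z = c}.
  by move=> z w zW wW; apply/u_th'; rewrite !cE.
have [[z0 z0W nz0]|below] := witness_below Wit th i.
  (* The solution [c] of [(1 - eps R k) * u i z0 + eps R k * c = K]. *)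
  exists ((K - (1 - eps R k) * u i z0) / eps R k) => z zW.
  rewrite -(opK (z0, z)); last by rewrite inE /= z0W zW nz0.
  rewrite exp_util_mix !exp_util_point_mass/=.
  by field; rewrite gt_eqF// eps_gt0.
exists K => z zW; rewrite -(opK (z, z)); last by rewrite inE /= zW below ?orbT.
by rewrite exp_util_option_diag.
Qed.

Lemma options_cover th i k z : z \in W th i ->
  exists2 p, p \in options th i & 0 < option_lottery k p z.
Proof.
move=> zW; have zz : 0 < point_mass z z :> R by rewrite /point_mass eqxx ltr01.
have [[z0 z0W nz0]|below] := witness_below Wit th i.
  exists (z0, z); first by rewrite inE /= z0W zW nz0.
  by apply: mix_gt0r => //; exact: lottery_point_mass.
exists (z, z); first by rewrite inE /= zW below ?orbT.
by apply: mix_gt0r => //; exact: lottery_point_mass.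
Qed.

Lemma pure_equilibrium_outcome (m : profile) :
  (forall i t, U i (upd m i t) <= U i m) ->
  forall z, 0 < canonical_outcome m z -> z = f th'.
Proof.
move=> br z oz.
have [i|none] := pickP (fun i => isSome (agreed m i)); last first.
  (* No agreement: the integer game has full support, so every outcome would be optimal for every
     agent. *)
  case: nonindifferent => i y w; have {}none j : agreed m j = None.
    by have := none j; case: (agreed m j).
  apply: (game_support_top (none i) (br i)); rewrite outcome_disagree//.
  by apply: mix_gt0r; [exact: lottery_point_mass|exact: uniform_gt0].
case ag : (agreed m i) => [[th k]|//] _.
have all := elimT (agreedP m i (th, k)) (introT eqP ag).
have oE := outcome_agree ag.
(* Either the announcement is unanimous, and a reversal would give some agent a profitable option,
   or [i] is the only dissenter. *)
have [mi|mi] := eqVneq (m i) (inl (th, k)).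
  have mE j : m j = inl (th, k) by have [->|/all] := eqVneq j i.
  have agj j : agreed m j = Some (th, k) by apply/eqP/agreedP => l _.
  rewrite mi eqxx in oE; move: oz; rewrite oE => /point_mass_gt0 ->.
  apply: contrapT => /(witness_reversal Wit)[j [x [y [xW yW fx rev]]]].
  have bj p : p \in options th j -> exp_util u j (option_lottery k p) <= u j (f th).
    move=> po; rewrite -[leRHS](exp_util_point_mass u j) -oE.
    exact: dissent_best_response (agj j) po (br j).
  have lt w : ~~ pref th' j (f th) w -> u j (f th) < u j w.
    by rewrite ltNge; apply: contra => /u_th'.
  case/orP: rev => /andP[fy yf].
    have := bj (y, y); rewrite exp_util_option_diag inE /= yW fy orbT => /(_ isT).
    by rewrite leNgt lt.
  (* [y] is strictly worse at [th], which makes the pair an option, but costs nothing at [th']; the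
     weight on [x] is positive for every [k], so the gain is strict. *)
  have := bj (y, x); rewrite exp_util_mix !exp_util_point_mass inE /= xW yW fy => /(_ isT).
  have ux := lt _ fx; have uy : u j (f th) <= u j y by apply/u_th'.
  have e0 := eps_gt0 R k; have e1 := eps_le1 R k.
  have : 0 < eps R k * (u j x - u j (f th)) by rewrite mulr_gt0// subr_gt0.
  have : 0 <= (1 - eps R k) * (u j y - u j (f th)) by rewrite mulr_ge0// subr_ge0.
  lra.
rewrite (negPf mi) in oE.
(* The other agents can thus start the integer game, so everything in the support is best for
   them. *)
have none j : j != i -> agreed m j = None.
  move=> ji; case E : (agreed m j) => [q|//].
  have allj := elimT (agreedP m j q) (introT eqP E).
  have [l /andP[li lj]] := exists_other2 i j.
  move: mi; rewrite (allj i) 1?eq_sym//.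
  by have := all l li; rewrite allj// => -[->]; rewrite eqxx.
have opU p : p \in options th i -> exp_util u i (option_lottery k p) <= U i m.
  by move=> po; exact: dissent_best_response ag po (br i).
(* The payoff mixes the chosen option with the average, and that option pays no more than the
   mixture; as the average has positive weight, it pays no less. All options then tie. *)
have avU : U i m <= exp_util u i (average (options th i) (option_lottery k)).
  have := opU _ (chosen_options th i k (m i)).
  rewrite oE [exp_util u i (dissent _ _ _ _)]exp_util_mix.
  set a := exp_util u i (option_lottery _ _); set b := exp_util u i (average _ _).
  set e := eps R _ => ab.
  have e0 : 0 < e by exact: eps_gt0.
  have : 0 <= e * (b - a) by lra.
  rewrite pmulr_rge0// => ba.
  have : 0 <= (1 - e) * (b - a) by rewrite mulr_ge0// subr_ge0 eps_le1.
  lra.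
have opK := exp_util_average_max opU avU.
have pos w : w \in W th i -> 0 < canonical_outcome m w.
  move=> /(options_cover k)[p po pw]; rewrite oE.
  apply: mix_gt0r; first exact: lottery_option.
  by apply: (average_gt0 _ po pw) => q _; exact: lottery_option.
have zW : z \in W th i.
  have optW p : p \in options th i -> 0 < option_lottery k p z -> z \in W th i.
    by rewrite inE => /and3P[p1 p2 _] /option_gt0[->|->].
  move: oz; rewrite oE => /mix_gt0[||/optW|].
  - exact: lottery_option.
  - exact: lottery_options.
  - by apply; exact: chosen_options.
  - by move=> /average_gt0_ex[|p po /(optW _ po)//] q _; exact: lottery_option.
apply: (witness_unanimous Wit (i := i) (th := th)) zW => [j y w ji yW|].
  exact: game_support_top (none j ji) (br j) (pos y yW) w.
exact: options_indifferent opK.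
Qed.

(** For a single option a strict loss in the first component outweighs the [eps] weight on the
    second once [k] is large; finiteness makes [k] uniform. *)
Lemma options_deter : exists k, forall i p, p \in options th' i ->
  exp_util u i (option_lottery k p) <= u i (f th').
Proof.
suff [k kP] : exists k, forall ip : 'I_n * (Z * Z), ip.2 \in options th' ip.1 ->
    exp_util u ip.1 (option_lottery k ip.2) <= u ip.1 (f th').
  by exists k => i p; exact: (kP (i, p)).
apply: eventually_forall => -[i [x y]] /=.
have [lt|ge] := ltP (u i x) (u i (f th')); last first.
  exists 0%N => k _; rewrite inE /= => /and3P[_ _ /orP[/negP[]|/andP[fx fy]]].
    exact/u_th'.
  apply: (exp_util_le (lottery_option _ _)) => z /option_gt0[->|->]; exact/u_th'.
have d0 : 0 < u i (f th') - u i x by rewrite subr_gt0.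
have [k0 small] := eps_small (total i) d0.
exists k0 => k /small le _; rewrite exp_util_mix !exp_util_point_mass/=.
have e0 := ltW (eps_gt0 R k).
have := mulr_ge0 e0 (u0 i x); have := ler_wpM2l e0 (le_total i y).
lra.
Qed.

Lemma announcement_equilibrium k :
  (forall i p, p \in options th' i ->
    exp_util u i (option_lottery k p) <= u i (f th')) ->
  forall i t, U i (upd [ffun=> inl (th', k)] i t) <= u i (f th').
Proof.
move=> det i t.
have ag : agreed [ffun=> inl (th', k)] i = Some (th', k).
  by apply/eqP/agreedP => j _; rewrite ffunE.
rewrite (outcome_agree (i := i) (th := th') (k := k)) ?agreed_upd// upd_in.
case: ifP => _; first by rewrite exp_util_point_mass.
apply: le_trans (dissent_le _ _ _ _) _.
by apply: det; case: (bestP i th' k).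
Qed.

End State.

End Payoffs.

End CanonicalMechanism.

(** * Pure profiles as Dirac mixtures, and the equivalence *)

Section DiracProfiles.
Variables (R : realType) (n : nat) (msg : 'I_n -> countType).
Local Notation profile := {dffun forall i, msg i}.

Lemma prob_dirac (m0 m : profile) : prob (fun i => dirac R (m0 i)) m = (m == m0)%:R.
Proof.
have [->|mm0] := eqVneq m m0; first by rewrite /prob big1// => i _; rewrite /dirac eqxx.
have [i mi] : exists i, m i != m0 i.
  apply/existsP; apply: contraNT mm0; rewrite negb_exists => /forallP h.
  by apply/eqP/ffunP => i; apply/eqP; rewrite -[_ == _]negbK h.
by rewrite (prob_bigD1 _ _ i) /dirac (negPf mi) mul0r.
Qed.

Lemma Ex_dirac (m0 : profile) (F : profile -> R) : 0 <= F m0 ->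
  Ex (fun i => dirac R (m0 i)) F = F m0.
Proof.
move=> F0; rewrite /Ex /eexp.
under eq_esum => m _ do rewrite prob_dirac EFinM.
by rewrite (@esum_dirac _ _ m0 (fun m => (F m)%:E)).
Qed.

End DiracProfiles.

Lemma implementable_R_of_witness (R : realType) (n : nat) (Z Theta : finType)
    (pref : Theta -> 'I_n -> rel Z) (f : Theta -> Z) (W : Theta -> 'I_n -> {set Z}) :
  (3 <= n)%N -> (forall th i, complete_preorder (pref th i)) ->
  deviation_witness pref f W -> (2 <= #|[set f th | th : Theta]|)%N ->
  MN_implementable_R R pref f.
Proof.
move=> n3 preP Wit fN; exists (canonical_mechanism R n3 preP Wit) => th u repr z.
(* Bounds every [|u i z|], so adding it makes the utilities nonnegative without changing the
   equilibria. *)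
pose c : R := \sum_i \sum_z `|u i z|.
pose u' i z := u i z + c.
have u'0 i w : 0 <= u' i w.
  have le : `|u i w| <= c.
    rewrite /c (bigD1 i)//= (bigD1 w)//= -addrA lerDl addr_ge0// sumr_ge0// => j _.
    by rewrite sumr_ge0.
  by move: le; rewrite ler_norml /u' => /andP[le _]; rewrite -lerBlDr sub0r.
have repr' : represents (pref th) u'.
  by move=> i x y; rewrite /u' lerD2r; exact: repr.
split=> [[lam [mne pos]]|->].
  have mne' := MNE_shift c mne.
  have [lmix _] := mne.
  have [m [pm oz]] := (induced_gt0P _ lmix).1 pos.
  have br := MNE_support_pure u'0 mne' (dominant_message n3 preP Wit u'0 z) pm.
  exact: (pure_equilibrium_outcome preP Wit repr' fN br oz).
have [k det] := options_deter f W u'0 repr'.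
pose m0 : {dffun forall i, msg (canonical_mechanism R n3 preP Wit) i} := [ffun=> inl (th, k)].
have lmix : mixed_profile (G := canonical_mechanism R n3 preP Wit) (fun i => dirac R (m0 i)).
  by move=> i; exact: mixed_dirac.
have ag i : agreed m0 i = Some (th, k).
  by apply/eqP/(agreedP n3) => j _; rewrite ffunE.
have i0 : 'I_n by exact: Ordinal n3.
have o0 : @outcome _ _ _ (canonical_mechanism R n3 preP Wit) m0 = point_mass (f th).
  by rewrite /= (outcome_agree _ _ _ _ _ (ag i0)) ffunE eqxx.
exists (fun i => dirac R (m0 i)); split; last first.
  apply/(induced_gt0P _ lmix); exists m0.
  by rewrite prob_dirac eqxx o0 /point_mass eqxx ltr01.
have : MNE (G := canonical_mechanism R n3 preP Wit) u' (fun i => dirac R (m0 i)).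
  apply/(MNE_pure_deviation _ u'0); split=> // i t.
  have p0 m : 0 <= payoff (G := canonical_mechanism R n3 preP Wit) u' i m.
    exact: (le_exp_util (outcome_lottery _)).
  rewrite !Ex_dirac//.
  rewrite /payoff o0 exp_util_point_mass.
  have := @announcement_equilibrium _ _ _ _ _ _ _ n3 preP Wit _ _ _ det i t; exact.
move=> /(MNE_shift (- c)); congr (MNE _ _).
by apply/funext => i; apply/funext => w; rewrite /u' addrK.
Qed.

Lemma implementable_R_of_Q (R : realType) (n : nat) (Z Theta : finType)
    (pref : Theta -> 'I_n -> rel Z) (f : Theta -> Z) :
  (3 <= n)%N -> (forall th i, complete_preorder (pref th i)) ->
  (2 <= #|[set f th | th : Theta]|)%N ->
  MN_implementable_Q R pref f -> MN_implementable_R R pref f.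
Proof.
move=> n3 preP fN [G impl].
have [W Wit] : exists W, deviation_witness pref f W.
  (* Natural-valued representations are special rational utilities. *)
  apply: (deviation_witness_of_nat preP (G := G)) => th v vP.
  have := impl th (fun i z => (v i z)%:R).
  rewrite (_ : (fun i z => _) = natu R v).
    by apply=> i x y; rewrite ler_nat; exact: vP.
  by apply/funext => i; apply/funext => z; rewrite ratr_nat.
exact: implementable_R_of_witness Wit fN.
Qed.

Theorem theorem4 (R : realType) (n : nat) (Z Theta : finType)
  (pref : Theta -> 'I_n -> rel Z) (f : Theta -> Z) :
  (3 <= n)%N ->
  (forall th i, complete_preorder (pref th i)) ->
  (2 <= #|[set f th | th : Theta]|)%N ->
  MN_implementable_R R pref f <-> MN_implementable_Q R pref f.
Proof.
(* From real to rational the same mechanism serves, since [ratr] preserves and reflects the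
   order. *)
move=> n3 preP fN; split; last exact: implementable_R_of_Q.
move=> [G impl]; exists G => th u repr; apply: impl => i z z'.
by rewrite ler_rat; exact: repr.
Qed.
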